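(* For each $n\ge1$ consider a noisy voter model $\mathrm{NVM}(V_n,P_n,p_n)$ with $|V_n|=n$, where $P_n$ is an irreducible transition matrix on $V_n$ with stationary distribution $\pi_n$, $p_n\in(0,1]$, and $(p_n)$ is non-increasing. Let $\pi_n^*=\max_{x\in V_n}\pi_n(x)$ and $\nu_n^2=\sum_{x\in V_n}\pi_n(x)^2$. If $$\Big(\frac{\pi_n^*}{\nu_n}\Big)^3\frac{n}{p_n}\to0\quad\text{as }n\to\infty,$$ then $W_n$ converges in distribution to $\mathcal N(0,1)$ as $n\to\infty$.
   Context: Noisy voter model: let $V$ be a finite set, $P$ an irreducible transition (stochastic) matrix on $V$ with stationary distribution $\pi$, and $p\in(0,1]$. $\mathrm{NVM}(V,P,p)$ is the discrete-time Markov chain on $\{0,1\}^V$ which at each step chooses a vertex $x\in V$ uniformly at random and updates only its opinion: with probability $p$ the opinion of $x$ is replaced by a fair coin flip in $\{0,1\}$; otherwise, with probability $1-p$, a vertex $y$ is chosen with probability $P(x,y)$ and the opinion of $x$ is replaced by the current opinion of $y$. For $p>0$ it has a unique stationary distribution $\Gamma$. With $\xi\sim\Gamma$, set $S=\sum_{x\in V}\pi(x)\xi(x)$, $\sigma^2=\mathrm{Var}(S)$ and $W=(S-\mathbb E(S))/\sigma$. A subscript $n$ (as in $W_n$) denotes these quantities for $\mathrm{NVM}(V_n,P_n,p_n)$. *)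

(* Defs.v *)
From HB Require Import structures.
From mathcomp Require Import all_boot all_order all_algebra.
From mathcomp Require Import all_classical all_reals all_analysis.
From mathcomp Require Import measurable_realfun.

Set Implicit Arguments.
Unset Strict Implicit.
Unset Printing Implicit Defensive.

Import Order.TTheory GRing.Theory Num.Theory.
Import numFieldNormedType.Exports.

Local Open Scope classical_set_scope.
Local Open Scope ring_scope.

Section FiniteMarkovChains.
Context {R : realType} {E : finType}.
Implicit Types (K : E -> E -> R) (m : E -> R).

Definition is_pmf m := (forall x, 0 <= m x) /\ \sum_x m x = 1.

Definition stochastic K := forall x, is_pmf (K x).

Fixpoint kernel_pow K (k : nat) (x y : E) : R :=
  if k is k'.+1 then \sum_z K x z * kernel_pow K k' z y else (x == y)%:R.

Definition irreducible K := forall x y, exists k, 0 < kernel_pow K k x y.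

Definition stationary K m :=
  is_pmf m /\ forall y, \sum_x m x * K x y = m y.

End FiniteMarkovChains.

Section NoisyVoterModel.
Context {R : realType} {V : finType}.

Definition update (eta : {ffun V -> bool}) (x : V) (b : bool) :
    {ffun V -> bool} := [ffun z => if z == x then b else eta z].

(* [nvm P p eta zeta] is the one-step transition probability from [eta] to
   [zeta]; opinions 0 and 1 are [false] and [true]. *)
Definition nvm (P : V -> V -> R) (p : R) (eta zeta : {ffun V -> bool}) : R :=
  \sum_(x : V) #|V|%:R^-1 *
    (p * (\sum_(b : bool) 2^-1 * (zeta == update eta x b)%:R)
     + (1 - p) * (\sum_(y : V) P x y * (zeta == update eta x (eta y))%:R)).

(* The base value 0 of the maximum is harmless: [pi] is nonnegative. *)
Definition pi_star (pi : V -> R) : R := \big[Num.max/0]_(x : V) pi x.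

Definition nu (pi : V -> R) : R := Num.sqrt (\sum_(x : V) pi x ^+ 2).

End NoisyVoterModel.

Section Statistics.
Context {R : realType} {V : finType} {d : measure_display}
  {T : measurableType d} (Pr : probability T R).
Implicit Type xi : V -> {RV Pr >-> bool}.

(* The random configuration [xi] has law [Gamma]. *)
Definition has_law xi (Gamma : {ffun V -> bool} -> R) :=
  forall eta : {ffun V -> bool},
    Pr [set w | forall x, xi x w = eta x] = (Gamma eta)%:E.

Definition S_stat (pi : V -> R) xi (w : T) : R :=
  \sum_(x : V) pi x * (xi x w)%:R.

Lemma measurable_S_stat pi xi : measurable_fun [set: T] (S_stat pi xi).
Proof.
rewrite /S_stat; apply: measurable_sum => x.
apply: measurable_funM; first exact: measurable_cst.
have mb : measurable_fun [set: bool] (fun b : bool => b%:R : R) by [].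
exact: (measurableT_comp mb).
Qed.

HB.instance Definition _ pi xi :=
  isMeasurableFun.Build _ _ _ _ (S_stat pi xi) (measurable_S_stat pi xi).

(* [S] is bounded, so its expectation and variance are finite and [fine] loses
   no information. *)
Definition sigma (pi : V -> R) xi : R :=
  Num.sqrt (fine 'V_Pr[S_stat pi xi]).

Definition W_stat (pi : V -> R) xi (w : T) : R :=
  (S_stat pi xi w - fine 'E_Pr[S_stat pi xi]) / sigma pi xi.

Lemma measurable_W_stat pi xi : measurable_fun [set: T] (W_stat pi xi).
Proof.
rewrite /W_stat; apply: measurable_funM => //.
by apply: measurable_funB => //; exact: measurable_S_stat.
Qed.

HB.instance Definition _ pi xi :=
  isMeasurableFun.Build _ _ _ _ (W_stat pi xi) (measurable_W_stat pi xi).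

Definition W_rv (pi : V -> R) xi : {RV Pr >-> R} := W_stat pi xi.

End Statistics.

(* The variables [X n] may live on different probability spaces. *)
Definition cvg_in_distribution (R : realType) (d : nat -> measure_display)
    (T : forall n, measurableType (d n)) (Pr : forall n, probability (T n) R)
    (X : forall n, {RV (Pr n) >-> R})
    (mu : probability (measurableTypeR R) R) :=
  forall t : R, {for t, continuous (fun r : R => mu `]-oo, r]%classic)} ->
    cdf (X n) t @[n --> \oo] --> mu `]-oo, t]%classic.

(* Main.v *)
From HB Require Import structures.
Require Import Defs.
From mathcomp Require Import all_boot all_order all_algebra.
From mathcomp Require Import all_classical all_reals all_analysis.
From mathcomp Require Import ring lra.

(** The proof is Stein's method for one step of the stationary chain.

Let [S] be the [pi]-weighted sum of opinions, [S'] its value after one step and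
[lam = p / n].  Stationarity of [pi] makes the drift exactly linear:
[E (S' - S | xi) = lam (1/2 - S)] ([wsum_drift]).  Hence [E S = 1/2], and the
normalised [W] satisfies [E (W' - W | xi) = - lam W].  Expanding
[E (F W' - F W) = 0] to second order, with [F] an antiderivative of [f], gives
([stein_stationary_chain]) that [E (f' W - W f W)] is small as soon as
- the jumps [W' - W] are small: they are at most [pi_star / sigma], and
- the conditional second moment [A = E ((W' - W)^2 | xi)], whose mean is
  [2 lam], is concentrated relative to [lam].

The concentration is where the voter dynamics enters.  For the Hamming distance
weighted by [pi], two copies of the chain driven by the same choices contract
on average by the factor [1 - lam] ([hamming_lip_step]), again because [pi] is
stationary.  Iterating the law of total variance then shows that a function
with Lipschitz constant [L] has variance at most [2 L^2 sigma^2] ([var_lip]).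
The function [n E ((S' - S)^2 | xi)] has constant [2 pi_star]
([sqr_increment_lip]).  Finally [E (S' - S)^2 = 2 lam sigma^2] and the fair
coins alone force [sigma >= nu / 2] ([var_wsum_ge]), so that altogether
[|E (f' W - W f W)| <= C pi_star / (nu p)] ([nvm_stein]).  Since
[sum pi^2 <= n pi_star^2], this is at most [C (pi_star / nu)^3 n / p].

It remains to solve Stein's equation for enough test functions.  Here a test
function is a ramp applied to the normal distribution function [Phi]: equal to
1 where [Phi <= a], equal to 0 where [Phi >= b] and linear in [Phi] in between.
As [Phi] of a normal variable is uniform, its normal mean is [(a + b) / 2], and
the solution is an explicit quotient by the density, with no integral.  In both
tails it is a multiple of a Mills ratio, whose classical bounds give a bounded
and Lipschitz derivative ([stein_solution]).  Ramps just above and just below a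
level [Phi t] sandwich the indicator of [W <= t]. *)

Set Implicit Arguments.
Unset Strict Implicit.
Unset Printing Implicit Defensive.

Import Order.TTheory GRing.Theory Num.Theory.
Import numFieldNormedType.Exports.

Local Open Scope classical_set_scope.
Local Open Scope ring_scope.

(** * Expectation and variance along a finite Markov chain *)

Section FiniteChain.
Context {R : realType} {E : finType}.
Implicit Types (K : E -> E -> R) (m g h : E -> R).

Definition expect m g : R := \sum_x m x * g x.

Definition step K g x : R := expect (K x) g.

Definition var m g : R := expect m (fun x => (g x - expect m g) ^+ 2).

Lemma eq_expect m g h : g =1 h -> expect m g = expect m h.
Proof. by move=> gh; apply: eq_bigr => x _; rewrite gh. Qed.

Lemma expectD m g h : expect m (fun x => g x + h x) = expect m g + expect m h.
Proof. by rewrite -big_split; apply: eq_bigr => x _; rewrite mulrDr. Qed.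

Lemma expectZ m c g : expect m (fun x => c * g x) = c * expect m g.
Proof. by rewrite [RHS]mulr_sumr; apply: eq_bigr => x _; rewrite mulrCA. Qed.

Lemma expectB m g h : expect m (fun x => g x - h x) = expect m g - expect m h.
Proof.
rewrite -[- expect m h]mulN1r -expectZ -expectD.
by apply: eq_expect => x; rewrite mulN1r.
Qed.

Lemma expect_cst m c : is_pmf m -> expect m (fun=> c) = c.
Proof. by case=> _ m1; rewrite /expect -mulr_suml m1 mul1r. Qed.

Lemma le_expect_supp m g h : is_pmf m ->
  (forall x, 0 < m x -> g x <= h x) -> expect m g <= expect m h.
Proof.
case=> m0 _ gh; apply: ler_sum => x _.
have [->|mx] := eqVneq (m x) 0; first by rewrite !mul0r.
by rewrite ler_wpM2l // gh // lt_neqAle eq_sym mx /=.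
Qed.

Lemma le_expect m g h : is_pmf m -> (forall x, g x <= h x) ->
  expect m g <= expect m h.
Proof. by move=> pm gh; apply: le_expect_supp. Qed.

Lemma expect_ge0 m g : is_pmf m -> (forall x, 0 <= g x) -> 0 <= expect m g.
Proof. by move=> pm g0; rewrite -(expect_cst 0 pm); apply: le_expect. Qed.

Lemma ler_norm_expect m g : is_pmf m ->
  `|expect m g| <= expect m (fun x => `|g x|).
Proof.
case=> m0 _; apply: (le_trans (ler_norm_sum _ _ _)).
by apply: ler_sum => x _; rewrite normrM ger0_norm.
Qed.

Lemma expect_sub_sqr m g c : is_pmf m ->
  expect m (fun x => (g x - c) ^+ 2) = var m g + (expect m g - c) ^+ 2.
Proof.
move=> pm; rewrite -[X in _ = _ + X](expect_cst _ pm) -[var _ _]addr0.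
rewrite -[X in _ = _ + X + _](mulr0 (2 * (expect m g - c))).
have <- : expect m (fun x => g x - expect m g) = 0.
  by rewrite expectB expect_cst // subrr.
rewrite -expectZ -!expectD; apply: eq_expect => x; ring.
Qed.

Lemma var_ge0 m g : is_pmf m -> 0 <= var m g.
Proof. by move=> pm; apply: expect_ge0 => // x; exact: sqr_ge0. Qed.

Lemma var_le m g c : is_pmf m -> var m g <= expect m (fun x => (g x - c) ^+ 2).
Proof. by move=> pm; rewrite expect_sub_sqr // lerDl sqr_ge0. Qed.

Lemma expect_norm_sqr m g : is_pmf m ->
  expect m (fun x => `|g x|) ^+ 2 <= expect m (fun x => g x ^+ 2).
Proof.
move=> pm; have := expect_sub_sqr (fun x => `|g x|) 0 pm.
rewrite subr0 (@eq_expect _ _ (fun x => g x ^+ 2)) => [->|x]; last first.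
  by rewrite subr0 real_normK ?num_real.
by rewrite lerDr var_ge0.
Qed.

Lemma expect_step K m g : stationary K m -> expect m (step K g) = expect m g.
Proof.
case=> _ st; rewrite /expect /step /expect.
under eq_bigr do rewrite mulr_sumr.
rewrite exchange_big /=; apply: eq_bigr => y _.
by rewrite -st mulr_suml; apply: eq_bigr => x _; rewrite mulrA.
Qed.

(** The law of total variance for one stationary step, where the conditional
    variance has been bounded by the second moment about the starting value. *)
Lemma var_step K m g : stochastic K -> stationary K m ->
  var m g <= expect m (fun x => step K (fun y => (g y - g x) ^+ 2) x)
             + var m (step K g).
Proof.
move=> sK st; have pm := st.1.
have -> : var m g = expect m (fun x => var (K x) g) + var m (step K g).
  rewrite {1}/var -(expect_step _ st) -(expect_step g st) -expectD.
  by apply: eq_expect => x; rewrite /step expect_sub_sqr.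
by rewrite lerD2r; apply: le_expect => // x; exact: var_le.
Qed.

(** Stationarity makes the two squares in [(W' - W)^2 = W'^2 - 2 W W' + W^2]
    have the same mean, and the linear drift evaluates the cross term. *)
Lemma expect_sqr_increment K m W lam : stochastic K -> stationary K m ->
  (forall x, step K W x = (1 - lam) * W x) ->
  expect m (fun x => step K (fun y => (W y - W x) ^+ 2) x)
  = 2 * lam * expect m (fun x => W x ^+ 2).
Proof.
move=> sK st drift.
have E1 x : step K (fun y => (W y - W x) ^+ 2) x =
    step K (fun y => W y ^+ 2) x - (1 - 2 * lam) * W x ^+ 2.
  transitivity (step K (fun y => W y ^+ 2 + (- (2 * W x) * W y + W x ^+ 2)) x).
    by apply: eq_expect => y; ring.
  rewrite /step !expectD expectZ expect_cst // -/(step K W x) drift; ring.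
rewrite (eq_expect _ E1) expectB expectZ expect_step //; ring.
Qed.

End FiniteChain.

(** * One-variable calculus *)

Section Calculus.
Context {R : realType}.
Implicit Types (f df F : R -> R) (a x y : R).

Lemma is_derive1_continuous f x l : is_derive x 1 f l -> {for x, continuous f}.
Proof.
by move=> fx; apply/differentiable_continuous/derivable1_diffP; exact: ex_derive.
Qed.

(** The two points come in either order.  Functions are differentiable on a ray
    only, because that is what [antiderivative_ray] provides. *)
Lemma MVT_ray f df a x y : (forall z, a < z -> is_derive z 1 f (df z)) ->
  a < x -> a < y ->
  exists c, [/\ a < c, `|c - x| <= `|y - x| & f y - f x = df c * (y - x)].
Proof.
move=> fdf ax ay.
have cont u v : a < u -> {within `[u, v], continuous f}.
  move=> au; apply: derivable_within_continuous => z; rewrite in_itv /= => /andP[uz _].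
  by have ? := fdf _ (lt_le_trans au uz); exact: ex_derive.
have seg u v : a < u -> u <= v ->
    exists2 c, c \in `[u, v]%R & f v - f u = df c * (v - u).
  move=> au uv; apply: MVT_segment => // [z|]; last exact: cont.
  by rewrite in_itv /= => /andP[uz _]; apply: fdf; exact: lt_trans uz.
have [xy|yx] := leP x y.
  have [c] := seg _ _ ax xy; rewrite in_itv /= => /andP[xc cy] E.
  exists c; split => //; first exact: lt_le_trans xc.
  by rewrite !ger0_norm ?subr_ge0 ?lerD2r // (le_trans xc).
have [c] := seg _ _ ay (ltW yx); rewrite in_itv /= => /andP[yc cx] E.
exists c; split; first exact: lt_le_trans yc.
  by rewrite !(distrC _ x) !ger0_norm ?subr_ge0 ?lerD2l ?lerN2 // ltW.
by rewrite -opprB E; ring.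
Qed.

Lemma derive_bounded_lipschitz f df (C : R) x y :
  (forall z : R, is_derive z 1 f (df z)) -> (forall z, `|df z| <= C) ->
  `|f y - f x| <= C * `|y - x|.
Proof.
move=> fdf dfC.
have [||c [_ _ ->]] := @MVT_ray f df (Num.min x y - 1) x y (fun z _ => fdf z).
- by rewrite ltrBlDr ltr_pwDr // ge_min lexx.
- by rewrite ltrBlDr ltr_pwDr // ge_min lexx orbT.
by rewrite normrM ler_wpM2r.
Qed.

Lemma antiderivative_ray f a : continuous f ->
  exists F, forall x, a < x -> is_derive x 1 F (f x).
Proof.
move=> cf; pose F x : R := (\int[lebesgue_measure]_(t in `[a, x]) f t)%R.
exists F => x ax.
have [||dF <-] := @continuous_FTC1_closed R f a x (x + 1) _ _ ax (cf x).
- by rewrite ltrDl.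
- apply: continuous_compact_integrable; first exact: segment_compact.
  exact: continuous_subspaceT.
by rewrite derive1E; exact: derivableP.
Qed.

Lemma taylor2_bound F f df a (L : R) x y :
  (forall z, a < z -> is_derive z 1 F (f z)) ->
  (forall z : R, is_derive z 1 f (df z)) ->
  (forall z w, `|df w - df z| <= L * `|w - z|) -> 0 <= L ->
  a < x -> a < y ->
  `|F y - F x - f x * (y - x) - df x * ((y - x) ^+ 2 / 2)| <= L * `|y - x| ^+ 3.
Proof.
move=> FE fE lip L0 ax ay.
pose G z := F z - f x * (z - x) - df x * ((z - x) ^+ 2 / 2).
pose g z := f z - f x - df x * (z - x).
have GE z : a < z -> is_derive z 1 G (g z).
  move=> az; rewrite /G /g; have FEz := FE z az.
  apply: is_derive_eq; rewrite /GRing.scale /=; by field.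
have [c [ac cx E]] := MVT_ray GE ax ay.
have -> : F y - F x - f x * (y - x) - df x * ((y - x) ^+ 2 / 2) = G y - G x.
  by rewrite /G; field.
rewrite E normrM exprSr mulrA ler_wpM2r // /g.
have [||e [_ ex ->]] := @MVT_ray f df (Num.min x c - 1) x c (fun z _ => fE z).
- by rewrite ltrBlDr ltr_pwDr // ge_min lexx.
- by rewrite ltrBlDr ltr_pwDr // ge_min lexx orbT.
rewrite -mulrBl normrM expr2 mulrA ler_pM //.
by apply: (le_trans (lip _ _)); rewrite ler_wpM2l // (le_trans ex).
Qed.

End Calculus.

Section QuadraticRemainder.
Context {R : realType}.

(** Proves differentiability of piecewise quadratic functions at their break
    points, where the differentiation rules do not apply. *)
Lemma is_derive_quadratic (g : R -> R) (v l C : R) :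
  (forall w, `|g w - g v - l * (w - v)| <= C * (w - v) ^+ 2) ->
  is_derive v 1 g l.
Proof.
move=> gC.
have C0 : 0 <= C.
  have := gC (v + 1); rewrite [v + 1 - v]addrC addKr expr1n !mulr1.
  exact: (le_trans (normr_ge0 _)).
suff cv : h^-1 *: (g (h *: 1 + v) - g v) @[h --> 0^'] --> l.
  by apply: DeriveDef; [apply/cvg_ex; exists l|exact: cvg_lim].
apply/cvgrPdist_le => e e0; near=> h.
have h0 : h != 0 by near: h; exact: nbhs_dnbhs_neq.
rewrite distrC -(ler_pM2l (_ : 0 < `|h|)) ?normr_gt0 // -normrM mulrBr.
rewrite /GRing.scale /= mulr1 mulVKf //.
have := gC (h + v); rewrite addrK (mulrC l) => /le_trans; apply.
rewrite -(real_normK (num_real h)) expr2 mulrCA ler_wpM2l //.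
apply: (@le_trans _ _ ((C + 1) * `|h|)); first by rewrite ler_wpM2r // lerDl.
rewrite mulrC -ler_pdivlMr ?ltr_wpDl //.
by near: h; apply: dnbhs0_le; rewrite divr_gt0 // ltr_wpDl.
Unshelve. all: by end_near. Qed.

Lemma is_derive_sqr_max0 (v : R) :
  is_derive v 1 (fun w => Num.max 0 w ^+ 2) (2 * Num.max 0 v).
Proof.
apply: (@is_derive_quadratic _ _ _ 1) => w; rewrite mul1r.
have [v0|v0] := leP 0 v; have [w0|w0] := leP 0 w; rewrite ler_norml;
  have := sqr_ge0 (w - v); have := sqr_ge0 w; have := sqr_ge0 v;
  move=> ? ? ?; apply/andP; split; nra.
Qed.
End QuadraticRemainder.

(** * Stein's method for a stationary chain with linear drift *)

Section SteinFiniteChain.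
Context {R : realType} {E : finType}.
Variables (K : E -> E -> R) (m W : E -> R) (lam : R).
Hypotheses (sK : stochastic K) (st : stationary K m).
Hypothesis drift : forall x, step K W x = (1 - lam) * W x.

Let A x := step K (fun y => (W y - W x) ^+ 2) x.

(** With [F' = f], stationarity gives [E (F W' - F W) = 0].  Conditionally on the
    present state, the first-order Taylor term is [- lam W f W] by the drift, the
    second-order term is [f' W A / 2], and the remainder is at most
    [L |W' - W|^3 <= L delta (W' - W)^2], of mean [2 lam L delta]. *)
Lemma stein_stationary_chain (f df : R -> R) (M L delta : R) :
  expect m (fun x => W x ^+ 2) = 1 -> 0 < lam ->
  (forall x y, 0 < K x y -> `|W y - W x| <= delta) ->
  (forall z : R, is_derive z 1 f (df z)) ->
  (forall z, `|df z| <= M) ->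
  (forall z w, `|df w - df z| <= L * `|w - z|) -> 0 <= L ->
  lam * `|expect m (fun x => df (W x) - W x * f (W x))|
  <= M / 2 * expect m (fun x => `|A x - 2 * lam|) + 2 * L * delta * lam.
Proof.
move=> W1 lam0 jump fdf dfM dfL L0; have pm := st.1.
(* [F] is only available on a ray, so the ray must contain all values of [W]. *)
pose a := - (1 + \sum_x `|W x|).
have aW x : a < W x.
  rewrite ltrNl; apply: (@le_lt_trans _ _ (\sum_x `|W x|)); last by rewrite ltrDr.
  rewrite (bigD1 x) //= (le_trans (ler_norm _)) // normrN lerDl sumr_ge0 //.
have [F FE] : exists F, forall z, a < z -> is_derive z 1 F (f z).
  by apply: antiderivative_ray => z; exact: is_derive1_continuous (fdf z).
pose D x := step K (fun y => F (W y) - F (W x)) x.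
have ED : expect m D = 0.
  rewrite (@eq_expect _ _ _ _ (fun x => step K (F \o W) x - (F \o W) x)).
    by rewrite expectB expect_step // subrr.
  by move=> x; rewrite /D /step expectB expect_cst.
have DE x : `|D x - df (W x) * (A x / 2) + lam * (W x * f (W x))|
    <= L * delta * A x.
  have inc : expect (K x) (fun y => W y - W x) = - (lam * W x).
    by rewrite expectB expect_cst // -/(step K W x) drift; ring.
  have -> : D x - df (W x) * (A x / 2) + lam * (W x * f (W x)) =
      expect (K x) (fun y => F (W y) - F (W x) +
        (- f (W x) * (W y - W x) + - (df (W x) / 2) * (W y - W x) ^+ 2)).
    rewrite (expectD _ (fun y => F (W y) - F (W x))).
    rewrite (expectD _ (fun y => - f (W x) * (W y - W x))).
    rewrite !expectZ inc -/(step K _ x) -/(D x) -/(step K _ x) -/(A x); ring.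
  apply: (le_trans (ler_norm_expect _ (sK x))).
  rewrite -expectZ; apply: le_expect_supp => // y Kxy.
  have := taylor2_bound FE fdf dfL L0 (aW x) (aW y).
  rewrite (_ : F (W y) - F (W x) - _ - _ = F (W y) - F (W x) +
        (- f (W x) * (W y - W x) + - (df (W x) / 2) * (W y - W x) ^+ 2)); last first.
    by field.
  move=> /le_trans; apply; rewrite -mulrA ler_wpM2l // exprS.
  by rewrite real_normK ?num_real // ler_wpM2r ?sqr_ge0 // jump.
have EA : expect m A = 2 * lam.
  by rewrite (expect_sqr_increment sK st drift) W1 mulr1.
rewrite -[in X in X * _](gtr0_norm lam0) -normrM -(expectZ m lam).
pose rem x := D x - df (W x) * (A x / 2) + lam * (W x * f (W x)).
have -> : expect m (fun x => lam * (df (W x) - W x * f (W x))) =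
    expect m (fun x => - (df (W x) / 2) * (A x - 2 * lam)) - expect m rem.
  rewrite -[RHS]addr0 -ED -expectB -expectD.
  by apply: eq_expect => x; rewrite /rem; field.
apply: (le_trans (ler_normB _ _)); apply: lerD.
  apply: (le_trans (ler_norm_expect _ pm)); rewrite -expectZ.
  apply: le_expect => // x; rewrite normrM normrN normrM ler_wpM2r //.
  rewrite (ger0_norm (_ : 0 <= 2^-1)) ?invr_ge0 ?ler0n //.
  by rewrite ler_wpM2r ?invr_ge0 ?ler0n.
apply: (le_trans (ler_norm_expect _ pm)).
have -> : 2 * L * delta * lam = expect m (fun x => L * delta * A x).
  by rewrite expectZ EA; ring.
exact: le_expect.
Qed.

End SteinFiniteChain.

(** * The noisy voter chain *)

Section Weights.
Context {R : realType} {V : finType}.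
Variable pi : V -> R.

Lemma pi_le_star x : pi x <= pi_star pi.
Proof. exact: (le_bigmax _ pi). Qed.

Lemma pi_star_ge0 : 0 <= pi_star pi.
Proof.
by rewrite /pi_star; elim/big_rec: _ => // x y _ y0; rewrite le_max y0 orbT.
Qed.

Lemma nu_sqr : nu pi ^+ 2 = \sum_x pi x ^+ 2.
Proof. by rewrite /nu sqr_sqrtr // sumr_ge0 // => x _; rewrite sqr_ge0. Qed.

End Weights.

Section NoisyVoterChain.
Context {R : realType} {V : finType}.
Variables (P : V -> V -> R) (p : R) (pi : V -> R).
Hypotheses (sP : stochastic P) (stP : stationary P pi) (p01 : 0 < p <= 1).

Notation config := {ffun V -> bool}.
Notation n := (#|V|%:R : R).
Notation K := (nvm P p).
Notation lam := (p / n).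
Implicit Types (eta zeta : config) (g : config -> R).

Let pi_ge0 x : 0 <= pi x. Proof. exact: stP.1.1. Qed.
Let pi_sum1 : \sum_x pi x = 1. Proof. exact: stP.1.2. Qed.
Let P_ge0 x y : 0 <= P x y. Proof. exact: (sP x).1. Qed.
Let P_sum1 x : \sum_y P x y = 1. Proof. exact: (sP x).2. Qed.
Let piP y : \sum_x pi x * P x y = pi y. Proof. exact: stP.2. Qed.
Let p_gt0 : 0 < p. Proof. by case/andP: p01. Qed.
Let p_le1 : p <= 1. Proof. by case/andP: p01. Qed.
Let star_ge0 : 0 <= pi_star pi. Proof. exact: pi_star_ge0. Qed.
Let q_ge0 : 0 <= 1 - p. Proof. by rewrite subr_ge0. Qed.

Let card_ge1 : 1 <= n.
Proof.
rewrite ler1n lt0n; apply: contra_eq_neq pi_sum1 => /card0_eq V0.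
by rewrite big_pred0 // eq_sym oner_eq0.
Qed.

Let n_gt0 : 0 < n. Proof. exact: lt_le_trans card_ge1. Qed.
Let n_neq0 : n != 0. Proof. by rewrite gt_eqF. Qed.
Let lam_gt0 : 0 < lam. Proof. by rewrite divr_gt0. Qed.
Let lam_le1 : lam <= 1.
Proof. by rewrite ler_pdivrMr // mul1r (le_trans p_le1). Qed.

Let sum_site (a : R) : \sum_(x : V) n^-1 * a = a.
Proof. by rewrite -mulr_sumr sumr_const -(mulr_natl a) mulKf. Qed.

Lemma nvm_stepE g eta : step K g eta =
  \sum_x n^-1 * (p * (\sum_(b : bool) 2^-1 * g (update eta x b))
                 + (1 - p) * (\sum_y P x y * g (update eta x (eta y)))).
Proof.
have pick (c : R) zeta0 : \sum_zeta c * (zeta == zeta0)%:R * g zeta = c * g zeta0.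
  rewrite (bigD1 zeta0) //= eqxx mulr1 big1 ?addr0 // => zeta /negbTE ->.
  by rewrite mulr0 mul0r.
rewrite /step /expect /nvm.
under [LHS]eq_bigr do rewrite mulr_suml.
rewrite exchange_big; apply: eq_bigr => x _ /=.
under eq_bigr do rewrite -mulrA mulrDl -!mulrA.
rewrite -mulr_sumr; congr (_ * _).
rewrite big_split /= -(mulr_sumr _ _ _ p) -(mulr_sumr _ _ _ (1 - p)).
congr (_ * _ + _ * _).
  under [LHS]eq_bigr do rewrite mulr_suml.
  rewrite exchange_big; apply: eq_bigr => b _; exact: pick.
under [LHS]eq_bigr do rewrite mulr_suml.
by rewrite exchange_big; apply: eq_bigr => b _; exact: pick.
Qed.

Let half_sum (a : R) : \sum_(b : bool) 2^-1 * a = a.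
Proof. by rewrite big_bool /=; field. Qed.

Lemma nvm_stochastic : stochastic K.
Proof.
move=> eta; split=> [zeta|].
  apply: sumr_ge0 => x _; rewrite mulr_ge0 ?invr_ge0 ?ler0n //.
  rewrite addr_ge0 // mulr_ge0 ?(ltW p_gt0) //; apply: sumr_ge0 => b _.
    by rewrite mulr_ge0 ?invr_ge0 ?ler0n.
  by rewrite mulr_ge0 ?ler0n.
have := nvm_stepE (fun=> 1) eta; rewrite /step /expect.
under eq_bigr do rewrite mulr1.
move=> ->; rewrite -[RHS]sum_site; apply: eq_bigr => x _; congr (_ * _).
by rewrite half_sum -mulr_suml P_sum1; ring.
Qed.

Lemma nvm_gt0_update eta zeta : 0 < K eta zeta ->
  exists x b, zeta = update eta x b.
Proof.
case: (pselect (exists x b, zeta = update eta x b)) => // H.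
have N x b : (zeta == update eta x b) = false.
  by apply/eqP => E; apply: H; exists x, b.
rewrite /nvm big1 ?ltxx // => x _.
by rewrite !big1 ?(mulr0, addr0) // => b _; rewrite N mulr0.
Qed.

Definition hamming eta zeta : R := \sum_x pi x * (eta x != zeta x)%:R.

Definition wsum eta : R := \sum_x pi x * (eta x)%:R.

Definition hamming_lip (L : R) g := forall eta zeta,
  `|g eta - g zeta| <= L * hamming eta zeta.

Lemma hamming_update eta zeta x b c :
  hamming (update eta x b) (update zeta x c) =
  hamming eta zeta - pi x * (eta x != zeta x)%:R + pi x * (b != c)%:R.
Proof.
rewrite /hamming (bigD1 x) //= [in RHS](bigD1 x) //= !ffunE eqxx.
rewrite (eq_bigr (fun y => pi y * (eta y != zeta y)%:R)); first by ring.
by move=> y /negbTE yx; rewrite !ffunE yx.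
Qed.

Lemma wsum_update eta x b :
  wsum (update eta x b) = wsum eta + pi x * (b%:R - (eta x)%:R).
Proof.
rewrite /wsum (bigD1 x) //= [in RHS](bigD1 x) //= !ffunE eqxx.
rewrite (eq_bigr (fun y => pi y * (eta y)%:R)); first by ring.
by move=> y /negbTE yx; rewrite !ffunE yx.
Qed.

Lemma hamming_le1 eta zeta : hamming eta zeta <= 1.
Proof.
rewrite -pi_sum1; apply: ler_sum => x _.
by rewrite ler_piMr //; case: (_ != _); rewrite ?ler01.
Qed.

Lemma hamming_ge0 eta zeta : 0 <= hamming eta zeta.
Proof. by apply: sumr_ge0 => x _; rewrite mulr_ge0. Qed.

Let sum_piP (h : V -> R) :
  \sum_x pi x * (\sum_y P x y * h y) = \sum_x pi x * h x.
Proof.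
under eq_bigr do rewrite mulr_sumr.
rewrite exchange_big; apply: eq_bigr => y _ /=.
by rewrite -piP mulr_suml; apply: eq_bigr => x _; rewrite mulrA.
Qed.

(** Copying an opinion along [P] preserves the mean of [S] because [pi] is
    stationary for [P]; only the coin flips pull [S], towards [1/2]. *)
Lemma wsum_drift eta : step K wsum eta = wsum eta + lam * (2^-1 - wsum eta).
Proof.
have site x : p * (\sum_(b : bool) 2^-1 * wsum (update eta x b))
      + (1 - p) * (\sum_y P x y * wsum (update eta x (eta y)))
    = wsum eta + (p / 2 * pi x - pi x * (eta x)%:R
                  + (1 - p) * (pi x * \sum_y P x y * (eta y)%:R)).
  have -> : \sum_y P x y * wsum (update eta x (eta y)) =
      wsum eta - pi x * (eta x)%:R + pi x * \sum_y P x y * (eta y)%:R.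
    transitivity (\sum_y (P x y * (wsum eta - pi x * (eta x)%:R)
                           + pi x * (P x y * (eta y)%:R))).
      by apply: eq_bigr => y _; rewrite wsum_update; ring.
    by rewrite big_split /= -mulr_suml P_sum1 mul1r mulr_sumr.
  by rewrite big_bool !wsum_update /=; field.
rewrite nvm_stepE; under eq_bigr do rewrite site mulrDr.
rewrite big_split /= sum_site -mulr_sumr !big_split /= -!mulr_sumr sum_piP.
rewrite sumrN pi_sum1 -/(wsum eta); field.
exact: n_neq0.
Qed.

(** Couple the steps from two configurations by the same vertex, the same coin and
    the same copied neighbour.  The chosen vertex loses its discrepancy and, when
    it copies [y], inherits that of [y]; averaging with the stationarity of [pi],
    the expected distance is multiplied by [1 - 1/n + (1 - p)/n = 1 - lam]. *)
Lemma hamming_lip_step L g : hamming_lip L g -> hamming_lip (L * (1 - lam)) (step K g).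
Proof.
move=> gL eta zeta.
pose del x : R := (eta x != zeta x)%:R.
have site x : `|(p * (\sum_(b : bool) 2^-1 * g (update eta x b))
        + (1 - p) * (\sum_y P x y * g (update eta x (eta y))))
      - (p * (\sum_(b : bool) 2^-1 * g (update zeta x b))
        + (1 - p) * (\sum_y P x y * g (update zeta x (zeta y))))|
    <= L * (hamming eta zeta - pi x * del x
            + (1 - p) * (pi x * \sum_y P x y * del y)).
  have bd b c : `|g (update eta x b) - g (update zeta x c)| <=
      L * (hamming eta zeta - pi x * del x + pi x * (b != c)%:R).
    by rewrite -hamming_update.
  have -> : L * (hamming eta zeta - pi x * del x
            + (1 - p) * (pi x * \sum_y P x y * del y)) =
      p * (\sum_(b : bool) 2^-1 * (L * (hamming eta zeta - pi x * del x)))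
      + (1 - p) * (\sum_y P x y *
          (L * (hamming eta zeta - pi x * del x + pi x * del y))).
    rewrite half_sum.
    under [in RHS]eq_bigr do rewrite [L * (_ + _)]mulrDr mulrDr.
    rewrite big_split /= -mulr_suml P_sum1.
    under [in X in _ = _ + _ * (_ + X)]eq_bigr do rewrite mulrCA (mulrCA _ (pi x)).
    rewrite -!mulr_sumr; ring.
  rewrite opprD addrACA -!mulrBr -!sumrB.
  apply: (le_trans (ler_normD _ _)).
  rewrite !normrM (ger0_norm q_ge0) (ger0_norm (ltW p_gt0)).
  apply: lerD; (rewrite ler_wpM2l ?(ltW p_gt0) //;
    apply: (le_trans (ler_norm_sum _ _ _)); apply: ler_sum => b _;
    rewrite -mulrBr normrM ger0_norm ?invr_ge0 ?ler0n //).
    rewrite ler_wpM2l ?invr_ge0 ?ler0n //.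
    by have := bd b b; rewrite eqxx mulr0 addr0.
  by rewrite ler_wpM2l.
rewrite !nvm_stepE -sumrB.
apply: (le_trans (ler_norm_sum _ _ _)).
apply: (@le_trans _ _ (\sum_x n^-1 * (L * (hamming eta zeta - pi x * del x
            + (1 - p) * (pi x * \sum_y P x y * del y))))).
  apply: ler_sum => x _; rewrite -mulrBr normrM ger0_norm ?invr_ge0 ?ler0n //.
  by rewrite ler_wpM2l ?invr_ge0 ?ler0n.
under eq_bigr do rewrite -addrA mulrDr mulrDr.
rewrite big_split /= sum_site -!mulr_sumr big_split /= -mulr_sumr sum_piP sumrN.
rewrite -/(hamming eta zeta) le_eqVlt; apply/orP; left; apply/eqP; field.
exact: n_neq0.
Qed.

Variable Gamma : config -> R.
Hypothesis stG : stationary K Gamma.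

Let pG : is_pmf Gamma. Proof. exact: stG.1. Qed.

Lemma expect_wsum : expect Gamma wsum = 2^-1.
Proof.
have := expect_step wsum stG.
rewrite (eq_expect _ wsum_drift) expectD expectZ expectB expect_cst //.
rewrite -[RHS]addr0 => /addrI/eqP; rewrite mulf_eq0 gt_eqF //= subr_eq0.
by move=> /eqP.
Qed.

Definition sqr_increment eta : R :=
  step K (fun zeta => (wsum zeta - wsum eta) ^+ 2) eta.

Lemma expect_sqr_increment_wsum :
  expect Gamma sqr_increment = 2 * lam * var Gamma wsum.
Proof.
rewrite /var expect_wsum.
rewrite -(@expect_sqr_increment _ _ K _ (fun eta => wsum eta - 2^-1) lam) //.
- apply: eq_expect => eta; apply: eq_expect => zeta; by rewrite opprB addrA subrK.
- exact: nvm_stochastic.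
move=> eta; rewrite /step expectB -/(step K _ _) wsum_drift.
rewrite expect_cst; last exact: nvm_stochastic.
ring.
Qed.

Lemma update_id eta x : update eta x (eta x) = eta.
Proof. by apply/ffunP => z; rewrite ffunE; case: eqP => // ->. Qed.

Lemma hamming_update_id eta x b :
  hamming (update eta x b) eta = pi x * (b != eta x)%:R.
Proof.
rewrite -{2}(update_id eta x) hamming_update eqxx mulr0 subr0.
by rewrite /hamming big1 ?add0r // => y _; rewrite eqxx mulr0.
Qed.

Lemma sqr_wsum_update eta x b :
  (wsum (update eta x b) - wsum eta) ^+ 2 = pi x ^+ 2 * (b != eta x)%:R.
Proof.
rewrite wsum_update addrC addKr exprMn.
by case: b (eta x) => [] [] /=; congr (_ * _); ring.
Qed.

(** One step of [var_step] costs [L^2 E (S' - S)^2 = 2 lam L^2 sigma^2] and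
    replaces [L] by [(1 - lam) L]; the costs add up to a geometric series, while
    the variance left after [k] steps is at most [L^2 (1 - lam)^k], the weighted
    Hamming distance being at most 1. *)
Lemma var_lip L g : hamming_lip L g -> var Gamma g <= 2 * L ^+ 2 * var Gamma wsum.
Proof.
set s2 := var Gamma wsum.
have s2_ge0 : 0 <= s2 by exact: var_ge0.
have r_ge0 : 0 <= 1 - lam by rewrite subr_ge0.
have bound k : forall L' g', hamming_lip L' g' ->
    var Gamma g' <= L' ^+ 2 * (2 * s2 + (1 - lam) ^+ k).
  elim: k => [|k IH] L' g' gL.
    pose eta0 : config := [ffun=> true].
    apply: (le_trans (var_le _ (g' eta0) pG)).
    apply: (@le_trans _ _ (expect Gamma (fun=> L' ^+ 2))); last first.
      by rewrite expect_cst // expr0 ler_peMr ?sqr_ge0 // lerDr mulr_ge0.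
    apply: le_expect => // eta.
    rewrite -[_ ^+ 2](real_normK (num_real _)) -[L' ^+ 2](real_normK (num_real _)).
    rewrite lerXn2r ?nnegrE //; apply: (le_trans (gL _ _)).
    apply: (le_trans (ler_norm _)); rewrite normrM ler_piMr //.
    by rewrite ger0_norm ?hamming_ge0 ?hamming_le1.
  apply: (le_trans (var_step _ nvm_stochastic stG)).
  have inc : expect Gamma (fun eta => step K (fun zeta => (g' zeta - g' eta) ^+ 2) eta)
      <= L' ^+ 2 * (2 * lam * s2).
    rewrite -expect_sqr_increment_wsum -expectZ; apply: le_expect => // eta.
    rewrite /sqr_increment /step -expectZ.
    apply: le_expect_supp => [|zeta /nvm_gt0_update [x [b ->]]].
      exact: nvm_stochastic.
    rewrite sqr_wsum_update; have := gL (update eta x b) eta.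
    rewrite hamming_update_id; case: (b != eta x); rewrite ?mulr1 ?mulr0.
      move=> H; rewrite -exprMn -[X in X <= _](real_normK (num_real _)).
      by rewrite lerXn2r ?nnegrE // (le_trans _ H).
    by rewrite normr_le0 => /eqP ->; rewrite expr0n.
  apply: (le_trans (lerD inc (IH _ _ (hamming_lip_step gL)))).
  rewrite -(subr_ge0 (_ + _)).
  have X0 : 0 <= 2 * s2 + (1 - lam) ^+ k by rewrite addr_ge0 ?mulr_ge0 ?exprn_ge0.
  have -> : L' ^+ 2 * (2 * s2 + (1 - lam) ^+ k.+1) - (L' ^+ 2 * (2 * lam * s2)
      + (L' * (1 - lam)) ^+ 2 * (2 * s2 + (1 - lam) ^+ k))
      = L' ^+ 2 * ((1 - lam) * lam * (2 * s2 + (1 - lam) ^+ k)).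
    by rewrite (exprS (1 - lam)); move: (_ ^+ k) => u; ring.
  by rewrite mulr_ge0 ?sqr_ge0 // !mulr_ge0 // ltW.
move=> gL.
have lim0 : (2 * L ^+ 2 * s2 + L ^+ 2 * (1 - lam) ^+ k) @[k --> \oo]
    --> 2 * L ^+ 2 * s2 + L ^+ 2 * 0.
  apply: cvgD; first exact: cvg_cst.
  apply: cvgMr; apply: cvg_expr.
  by rewrite ger0_norm // gtrBl.
rewrite mulr0 addr0 in lim0.
apply: (@cvgr_to_ge _ _ _ _ _ _ _ lim0); apply: nearW => k.
by apply: (le_trans (bound k _ _ gL)); rewrite mulrDr mulrA (mulrC _ 2).
Qed.

(** Opinions being 0 or 1, a square of a difference is the indicator of a
    disagreement, and a coin flip changes the opinion with probability 1/2. *)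
Lemma sqr_incrementE eta : sqr_increment eta =
  \sum_x n^-1 * (pi x ^+ 2 *
    (p / 2 + (1 - p) * \sum_y P x y * (eta y != eta x)%:R)).
Proof.
rewrite /sqr_increment nvm_stepE; apply: eq_bigr => x _; congr (_ * _).
rewrite big_bool !sqr_wsum_update.
have -> : \sum_y P x y * (wsum (update eta x (eta y)) - wsum eta) ^+ 2 =
    pi x ^+ 2 * \sum_y P x y * (eta y != eta x)%:R.
  rewrite mulr_sumr; apply: eq_bigr => y _; rewrite sqr_wsum_update; ring.
by case: (eta x) => /=; field.
Qed.

(** A disagreement at a vertex is felt twice: when that vertex is updated, and when
    it is copied.  Each effect is weighted by a square of [pi]; bounding one factor
    by [pi_star] leaves a [pi]-weighted discrepancy, by stationarity of [pi] for
    the second effect. *)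
Lemma sqr_increment_lip : hamming_lip (2 * pi_star pi / n) sqr_increment.
Proof.
move=> eta zeta; rewrite !sqr_incrementE -sumrB.
pose del x : R := (eta x != zeta x)%:R.
apply: (@le_trans _ _ (\sum_x n^-1 * (pi_star pi *
    (pi x * del x + pi x * \sum_y P x y * del y)))); last first.
  rewrite -!mulr_sumr big_split /= sum_piP.
  by rewrite le_eqVlt; apply/orP; left; apply/eqP; rewrite /hamming; field.
apply: (le_trans (ler_norm_sum _ _ _)); apply: ler_sum => x _.
rewrite -mulrBr normrM ger0_norm ?invr_ge0 ?ler0n // ler_wpM2l ?invr_ge0 ?ler0n //.
rewrite -mulrBr opprD addrACA subrr add0r -mulrBr -sumrB.
rewrite normrM ger0_norm ?sqr_ge0 // expr2 -mulrDr -mulrA.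
apply: ler_pM; rewrite ?mulr_ge0 ?pi_le_star // ler_wpM2l //.
rewrite normrM (ger0_norm q_ge0).
apply: (@le_trans _ _ (1 * \sum_y P x y * (del x + del y))); last first.
  rewrite mul1r; under eq_bigr do rewrite mulrDr.
  by rewrite big_split /= -mulr_suml P_sum1 mul1r.
apply: ler_pM => //; first by rewrite gerBl ltW.
apply: (le_trans (ler_norm_sum _ _ _)); apply: ler_sum => y _.
rewrite -mulrBr normrM ger0_norm // ler_wpM2l // /del.
by case: (eta x) (eta y) (zeta x) (zeta y) => [] [] [] [] /=;
  rewrite ?subrr ?subr0 ?sub0r ?normrN ?normr1 ?normr0 ?addr0 ?add0r ?ler01 ?ler0n //;
  rewrite -natrD ler1n.
Qed.

(** Coin flips alone make [E (S' - S)^2 >= (p / 2n) nu^2], and the left side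
    equals [2 (p / n) Var S]. *)
Lemma var_wsum_ge : nu pi ^+ 2 / 4 <= var Gamma wsum.
Proof.
have : n^-1 * (nu pi ^+ 2 * (p / 2)) <= expect Gamma sqr_increment.
  rewrite -(expect_cst (n^-1 * (nu pi ^+ 2 * (p / 2))) pG).
  apply: le_expect => // eta; rewrite sqr_incrementE -mulr_sumr.
  rewrite ler_wpM2l ?invr_ge0 ?ler0n // nu_sqr mulr_suml; apply: ler_sum => x _.
  rewrite ler_wpM2l ?sqr_ge0 // lerDl mulr_ge0 // sumr_ge0 // => y _.
  by rewrite mulr_ge0.
rewrite expect_sqr_increment_wsum.
have -> : n^-1 * (nu pi ^+ 2 * (p / 2)) = 2 * lam * (nu pi ^+ 2 / 4).
  by field; exact: n_neq0.
by rewrite ler_pM2l // mulr_gt0.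
Qed.

Lemma nu_gt0 : 0 < nu pi.
Proof.
rewrite /nu sqrtr_gt0 lt_neqAle sumr_ge0 ?andbT => [|x _]; last exact: sqr_ge0.
rewrite eq_sym; apply: contra_eq_neq pi_sum1.
move=> /eqP; rewrite psumr_eq0 => [/allP pi0|x _]; last exact: sqr_ge0.
rewrite big1 ?(eq_sym 0) ?oner_eq0 // => x _.
by have := pi0 x (mem_index_enum x); rewrite /= sqrf_eq0 => /eqP.
Qed.

Let sig := Num.sqrt (var Gamma wsum).

Let sig_ge : nu pi / 2 <= sig.
Proof.
rewrite -(@ler_sqr R) ?nnegrE ?sqrtr_ge0 ?divr_ge0 ?(ltW nu_gt0) //.
rewrite sqr_sqrtr ?var_ge0 // (le_trans _ var_wsum_ge) //.
by rewrite le_eqVlt; apply/orP; left; apply/eqP; field.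
Qed.

Let sig_gt0 : 0 < sig.
Proof. by apply: lt_le_trans sig_ge; rewrite divr_gt0 // nu_gt0. Qed.

Let sig_sqr : sig ^+ 2 = var Gamma wsum.
Proof. by rewrite sqr_sqrtr // var_ge0. Qed.

(** Instance of [stein_stationary_chain] for the normalised sum, with the first
    absolute moment of [A - 2 lam] bounded by its standard deviation. *)
Lemma nvm_stein (f df : R -> R) (M L : R) :
  (forall z : R, is_derive z 1 f (df z)) ->
  (forall z, `|df z| <= M) ->
  (forall z w, `|df w - df z| <= L * `|w - z|) -> 0 <= L ->
  `|expect Gamma (fun eta => df ((wsum eta - 2^-1) / sig)
      - (wsum eta - 2^-1) / sig * f ((wsum eta - 2^-1) / sig))|
  <= (3 * M + 4 * L) * (pi_star pi / nu pi / p).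
Proof.
move=> fdf dfM dfL L0; pose W eta := (wsum eta - 2^-1) / sig.
have M0 : 0 <= M by exact: le_trans (normr_ge0 _) (dfM 0).
have sig0 : sig != 0 by rewrite gt_eqF.
have WB eta zeta : W zeta - W eta = (wsum zeta - wsum eta) / sig.
  by rewrite /W -mulrBl opprB addrA subrK.
have drift eta : step K W eta = (1 - lam) * W eta.
  have -> : step K W eta = expect (K eta) (fun zeta => sig^-1 * (wsum zeta - 2^-1)).
    by apply: eq_expect => zeta; rewrite mulrC.
  rewrite expectZ expectB -/(step K wsum eta) wsum_drift expect_cst.
    by rewrite /W; ring.
  exact: nvm_stochastic.
have W1 : expect Gamma (fun eta => W eta ^+ 2) = 1.
  rewrite (@eq_expect _ _ _ _ (fun eta => sig ^- 2 * (wsum eta - 2^-1) ^+ 2)).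
    by rewrite expectZ -expect_wsum -/(var _ _) -sig_sqr mulVf // expf_neq0.
  by move=> eta; rewrite /W exprMn exprVn mulrC.
have jump eta zeta : 0 < K eta zeta -> `|W zeta - W eta| <= pi_star pi / sig.
  move=> /nvm_gt0_update [x [b ->]].
  rewrite WB wsum_update addrC addKr !normrM normfV (gtr0_norm sig_gt0).
  rewrite ler_wpM2r ?invr_ge0 ?(ltW sig_gt0) // ger0_norm //.
  rewrite -[leRHS]mulr1 ler_pM ?pi_le_star //.
  by case: b (eta x) => [] [] /=;
    rewrite ?subrr ?subr0 ?sub0r ?normrN ?normr1 ?normr0 ?ler01.
have := stein_stationary_chain nvm_stochastic stG drift W1 lam_gt0 jump fdf dfM dfL L0.
set X := expect Gamma (fun eta => _ - _); set Y := expect Gamma (fun=> `| _ |).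
have AE eta : step K (fun zeta => (W zeta - W eta) ^+ 2) eta =
    sig ^- 2 * sqr_increment eta.
  rewrite /sqr_increment /step -expectZ; apply: eq_expect => zeta.
  by rewrite WB exprMn exprVn mulrC.
have EA : expect Gamma sqr_increment = 2 * lam * sig ^+ 2.
  by rewrite expect_sqr_increment_wsum sig_sqr.
have Yle : Y <= 3 * pi_star pi / (n * sig).
  have Z0 : 0 <= 3 * pi_star pi / (n * sig).
    by rewrite divr_ge0 ?mulr_ge0 ?ler0n // ltW.
  rewrite -(@ler_sqr R) ?nnegrE //; last by apply: expect_ge0.
  apply: (le_trans (expect_norm_sqr _ pG)).
  have -> : expect Gamma (fun eta => (step K (fun zeta => (W zeta - W eta) ^+ 2) eta
      - 2 * lam) ^+ 2) = sig ^- 4 * var Gamma sqr_increment.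
    rewrite /var EA -expectZ; apply: eq_expect => eta; rewrite AE; field.
    by rewrite sig0 n_neq0.
  apply: (@le_trans _ _ (sig ^- 4 *
      (2 * (2 * pi_star pi / n) ^+ 2 * var Gamma wsum))).
    rewrite ler_wpM2l ?invr_ge0 ?exprn_ge0 ?(ltW sig_gt0) //.
    exact: var_lip sqr_increment_lip.
  rewrite -sig_sqr -subr_ge0.
  have -> : (3 * pi_star pi / (n * sig)) ^+ 2 - sig ^- 4 *
     (2 * (2 * pi_star pi / n) ^+ 2 * sig ^+ 2) = (pi_star pi / (n * sig)) ^+ 2.
    by field; rewrite sig0 n_neq0.
  exact: sqr_ge0.
move=> H.
have {H} H : lam * `|X| <= M / 2 * (3 * pi_star pi / (n * sig))
    + 2 * L * (pi_star pi / sig) * lam.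
  by apply: (le_trans H); rewrite lerD2r ler_wpM2l // divr_ge0.
have {H} H : `|X| <= (3 / 2 * M / p + 2 * L) * (pi_star pi / sig).
  rewrite -(ler_pM2l lam_gt0) (le_trans H) // le_eqVlt; apply/orP; left; apply/eqP.
  by field; rewrite sig0 n_neq0 gt_eqF.
apply: (le_trans H).
have isig : sig^-1 <= 2 / nu pi.
  by rewrite -[2 / nu pi]invf_div lef_pV2 // posrE ?divr_gt0 ?nu_gt0.
have ip : 1 <= p^-1 by rewrite invf_ge1.
have -> : (3 * M + 4 * L) * (pi_star pi / nu pi / p) =
  (3 / 2 * M / p + 2 * L / p) * (pi_star pi * (2 / nu pi)).
  by field; rewrite !gt_eqF ?nu_gt0.
apply: ler_pM.
- by rewrite addr_ge0 // !mulr_ge0 ?invr_ge0 // ltW.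
- by rewrite divr_ge0 // ltW.
- by rewrite lerD2l ler_peMr // mulr_ge0.
- by rewrite ler_wpM2l.
Qed.

End NoisyVoterChain.

(** * The normal distribution function and Mills' ratio *)

Section StandardNormal.
Context {R : realType}.

Definition phi : R -> R := normal_pdf 0 1.
Definition Phi (t : R) : R := fine (normal_prob (0 : R) 1 `]-oo, t]).

Lemma phiE x : phi x = normal_peak 1 * expR (- (x ^+ 2 / 2)).
Proof.
rewrite /phi normal_pdfE ?oner_eq0 // /normal_fun subr0 expr1n mulNr.
by rewrite mulr2n.
Qed.

Lemma phi_gt0 x : 0 < phi x.
Proof. by rewrite phiE mulr_gt0 ?expR_gt0 // normal_peak_gt0 ?oner_eq0. Qed.

Lemma phi_le x : phi x <= normal_peak 1.
Proof. by apply: normal_pdf_ub; exact: oner_neq0. Qed.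

Lemma phiN x : phi (- x) = phi x.
Proof. by rewrite !phiE sqrrN. Qed.

Lemma is_derive_phi (x : R) : is_derive x 1 phi (- x * phi x).
Proof.
rewrite (_ : phi = fun y => normal_peak 1 * expR (- (y ^+ 2 / 2))); last first.
  by apply/funext => y; rewrite phiE.
have H : is_derive x 1 (fun y : R => - (y ^+ 2 / 2)) (- x).
  by apply: is_derive_eq; rewrite /GRing.scale /=; field.
have H2 := @is_derive1_comp _ expR _ x _ _ (is_derive_expR _) H.
apply: (@is_derive_eq _ _ _ _ _ _ _ _ (is_deriveZ _ _)).
rewrite /GRing.scale /=; ring.
Qed.

Lemma is_derive_Phi (x : R) : is_derive x 1 Phi (phi x).
Proof.
have [|||| dP <-] := @continuous_FTC1 R phi -oo%O x (x + 1).
- by rewrite ltrDl.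
- apply: (integrableS _ _ (@subsetT _ _)) => //.
  exact: integrable_normal_pdf.
- by rewrite ltNyr.
- by apply: continuous_normal_pdf; exact: oner_neq0.
by rewrite derive1E; exact: derivableP.
Qed.

(** [Phi] is the distribution function of the identity under the normal law, which
    gives access to the general facts on distribution functions. *)
Let idR : measurableTypeR R -> R := idfun.
#[local] HB.instance Definition _ :=
  @isMeasurableFun.Build _ _ _ _ idR (@measurable_id _ _ setT).
Let N01 := normal_prob (0 : R) 1 : probability (measurableTypeR R) R.

Let cdf_id (x : R) : cdf (idR : {RV N01 >-> R}) x = (Phi x)%:E.
Proof. by rewrite /Phi fineK ?fin_num_measure //. Qed.

Lemma normal_prob_Phi t : normal_prob (0 : R) 1 `]-oo, t] = (Phi t)%:E.
Proof. by rewrite -cdf_id. Qed.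

Lemma Phi_ge0 x : 0 <= Phi x.
Proof. by rewrite -lee_fin -cdf_id cdf_ge0. Qed.

Lemma Phi_le1 x : Phi x <= 1.
Proof. by rewrite -lee_fin -cdf_id cdf_le1. Qed.

Lemma Phi_cvgy : Phi x @[x --> +oo] --> (1 : R).
Proof.
have := cvg_cdfy1 (idR : {RV N01 >-> R}).
by rewrite (_ : cdf _ = EFin \o Phi); [move/fine_cvgP => [] | apply/funext].
Qed.

Lemma Phi_cvgNy : Phi x @[x --> -oo] --> (0 : R).
Proof.
have := cvg_cdfNy0 (idR : {RV N01 >-> R}).
by rewrite (_ : cdf _ = EFin \o Phi); [move/fine_cvgP => [] | apply/funext].
Qed.

End StandardNormal.

Section MillsRatio.
Context {R : realType}.
(** [Q] stands for the upper normal tail.  It is kept abstract so as to cover both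
    [1 - Phi] and [x |-> Phi (- x)]. *)
Variable Q : R -> R.
Hypothesis Q_ge0 : forall x, 0 <= Q x.
Hypothesis Q_cvg0 : Q x @[x --> +oo] --> (0 : R).
Hypothesis dQ : forall x : R, is_derive x 1 Q (- phi x).

Let ninc (g dg : R -> R) x y : (forall z : R, 0 < z -> is_derive z 1 g (dg z)) ->
  (forall z, 0 < z -> dg z <= 0) -> 0 < x -> x <= y -> g y <= g x.
Proof.
move=> gE dg0 x0 xy.
have [c [c0 _ E]] := MVT_ray gE x0 (lt_le_trans x0 xy).
by rewrite -subr_le0 E mulr_le0_ge0 ?subr_ge0 // dg0.
Qed.

(** The difference of the two sides is nonincreasing and its lower limit at
    infinity is nonnegative; the same argument gives the next bound. *)
Lemma mills_le x : 0 < x -> Q x <= phi x / x.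
Proof.
move=> x0; pose g z := phi z / z - Q z.
have gE (z : R) : 0 < z -> is_derive z 1 g (- phi z / z ^+ 2).
  move=> z0; have zn0 : z != 0 by rewrite gt_eqF.
  have H1 := is_deriveV zn0 (is_derive_id z 1).
  have H2 := is_derive_phi z; have H3 := dQ z.
  apply: is_derive_eq; rewrite /GRing.scale /=; by field.
suff : 0 <= g x by rewrite subr_ge0.
have Qn : - Q y @[y --> +oo] --> (0 : R) by rewrite -oppr0; exact: cvgN.
apply: (cvgr_to_le Qn); near=> y.
have xy : x <= y by near: y; apply: nbhs_pinfty_ge; rewrite num_real.
have y0 := lt_le_trans x0 xy.
apply: (@le_trans _ _ (g y)).
  by rewrite /g -[X in X <= _]add0r lerD2r divr_ge0 // ltW // phi_gt0.
apply: (ninc gE) => // z z0; rewrite mulNr oppr_le0 divr_ge0 ?sqr_ge0 //.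
by rewrite ltW // phi_gt0.
Unshelve. all: by end_near. Qed.

Lemma mills_ge x : 0 < x -> phi x * (x^-1 - x ^- 3) <= Q x.
Proof.
move=> x0; pose g z := Q z - phi z * (z^-1 - z^-1 ^+ 3).
have gE (z : R) : 0 < z -> is_derive z 1 g (- (3 * phi z * z^-1 ^+ 4)).
  move=> z0; have zn0 : z != 0 by rewrite gt_eqF.
  have H1 := is_deriveV zn0 (is_derive_id z 1).
  have H2 := is_derive_phi z; have H3 := dQ z.
  apply: is_derive_eq; rewrite /GRing.scale /=; by field.
rewrite -exprVn -subr_ge0 -/(g x).
have ln : - (normal_peak (1 : R) * y^-1) @[y --> +oo] --> (0 : R).
  rewrite -oppr0; apply: cvgN; rewrite -[X in _ --> X](mulr0 (normal_peak (1 : R))).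
  apply: cvgMr; apply/(@gtr0_cvgV0 _ _ _ _ id); last exact: cvg_id.
  by apply: nbhs_pinfty_gt; rewrite num_real.
apply: (cvgr_to_le ln); near=> y.
have xy : x <= y by near: y; apply: nbhs_pinfty_ge; rewrite num_real.
have y0 := lt_le_trans x0 xy.
apply: (@le_trans _ _ (g y)).
  apply: (@le_trans _ _ (- (phi y * y^-1))).
    by rewrite lerN2 ler_wpM2r ?invr_ge0 ?(ltW y0) // phi_le.
  rewrite /g mulrBr opprB addrA lerDr addr_ge0 //.
  by rewrite mulr_ge0 ?exprn_ge0 ?invr_ge0 ?(ltW y0) // ltW // phi_gt0.
apply: (ninc gE) => // z z0; rewrite oppr_le0.
by rewrite !mulr_ge0 ?exprn_ge0 ?invr_ge0 ?(ltW z0) // ltW // phi_gt0.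
Unshelve. all: by end_near. Qed.

(** With [m = Q / phi], these are the sizes of the first and second derivatives:
    [m' = x m - 1] and [m'' = (1 + x^2) m - x]. *)
Lemma mills_bounds x : 1 <= x ->
  `|x * (Q x / phi x) - 1| <= 1 /\ `|(1 + x ^+ 2) * (Q x / phi x) - x| <= 1.
Proof.
move=> x1; have x0 : 0 < x by exact: lt_le_trans x1.
set m := Q x / phi x; pose u := x^-1.
have u0 : 0 < u by rewrite invr_gt0.
have xu : x * u = 1 by rewrite mulfV // gt_eqF.
have u1 : u <= 1 by rewrite invf_le1.
have mu : m <= u by rewrite ler_pdivrMr ?phi_gt0 // mulrC mills_le.
have um : u - u ^+ 3 <= m by rewrite ler_pdivlMr ?phi_gt0 // mulrC exprVn mills_ge.
have up : x * m <= 1 by rewrite -xu ler_wpM2l // ltW.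
have lo : 1 - u ^+ 2 <= x * m.
  have -> : 1 - u ^+ 2 = x * (u - u ^+ 3) by rewrite mulrBr exprS mulrA xu mul1r.
  by rewrite ler_wpM2l // ltW.
have u2 : u ^+ 2 <= 1 by rewrite exprn_ile1 // ltW.
have u3 : u ^+ 3 <= 1 by rewrite exprn_ile1 // ltW.
split; rewrite ler_norml; apply/andP; split; try lra.
  have : (1 + x ^+ 2) * (u - u ^+ 3) <= (1 + x ^+ 2) * m.
    by rewrite ler_wpM2l // addr_ge0 ?sqr_ge0.
  have -> : (1 + x ^+ 2) * (u - u ^+ 3) =
      u - u ^+ 3 + x * (x * u) - x * u * (x * u) * u.
    by ring.
  rewrite xu; lra.
have : (1 + x ^+ 2) * m <= (1 + x ^+ 2) * u.
  by rewrite ler_wpM2l // addr_ge0 ?sqr_ge0.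
have -> : (1 + x ^+ 2) * u = u + x * (x * u) by ring.
rewrite xu; lra.
Qed.

End MillsRatio.

(** * Solving Stein's equation for ramps of the normal distribution function *)

Section SteinSolution.
Context {R : realType}.

Lemma bounded_from_tails (g : R -> R) (X C : R) : continuous g ->
  (forall x, X <= `|x| -> `|g x| <= C) -> exists M, forall x, `|g x| <= M.
Proof.
move=> cg gC; pose Y := Num.max 0 X.
have cn : {within `[- Y, Y], continuous (fun x => `|g x|)}.
  apply: continuous_subspaceT => x; exact: cvg_norm (cg x).
have [|c _ cM] := @EVT_max R (fun x => `|g x|) (- Y) Y _ cn.
  by rewrite ge0_cp // le_max lexx.
exists (Num.max C `|g c|) => x; rewrite le_max; apply/orP.
have [xX|xX] := leP X `|x|; [left; exact: gC|right].
by apply: cM; rewrite in_itv /= -ler_norml le_max (ltW xX) orbT.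
Qed.

Variables a b : R.
Hypotheses (a0 : 0 < a) (ab : a < b) (b1 : b < 1).

Definition ramp (v : R) : R := 1 - (Num.max 0 (v - a) - Num.max 0 (v - b)) / (b - a).

Definition ramp_prim (v : R) : R :=
  v - (Num.max 0 (v - a) ^+ 2 - Num.max 0 (v - b) ^+ 2) / (2 * (b - a)).

Let ba0 : 0 < b - a. Proof. by rewrite subr_gt0. Qed.
Let ba_neq0 : b - a != 0. Proof. by rewrite gt_eqF. Qed.
Let B := (a + b) / 2.

Lemma ramp_eq1 v : v <= a -> ramp v = 1 /\ ramp_prim v = v.
Proof.
move=> va; have vb := le_trans va (ltW ab).
rewrite /ramp /ramp_prim !max_l ?subr_le0 //.
by rewrite !subrr !mul0r !subr0.
Qed.

Lemma ramp_eq0 v : b <= v -> ramp v = 0 /\ ramp_prim v = B.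
Proof.
move=> bv; have av := le_trans (ltW ab) bv.
by rewrite /ramp /ramp_prim !max_r ?subr_ge0 // /B; split; field.
Qed.

Lemma ramp_lipschitz v w : `|ramp w - ramp v| <= (b - a)^-1 * `|w - v|.
Proof.
have -> : ramp w - ramp v = (b - a)^-1 *
   ((Num.max 0 (v - a) - Num.max 0 (v - b)) - (Num.max 0 (w - a) - Num.max 0 (w - b))).
  by rewrite /ramp; field.
rewrite normrM (gtr0_norm (_ : 0 < (b - a)^-1)) ?invr_gt0 //.
rewrite ler_wpM2l ?invr_ge0 ?(ltW ba0) //.
have := ab; rewrite ler_norml; case: (ler0P (w - v)) => ?;
case: (leP 0 (v - a)) => ?; case: (leP 0 (v - b)) => ?;
case: (leP 0 (w - a)) => ?; case: (leP 0 (w - b)) => ? ?; apply/andP; split; lra.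
Qed.

Lemma ramp_ge0_le1 v : 0 <= ramp v <= 1.
Proof.
have [va|va] := leP v a; first by rewrite (ramp_eq1 va).1 ler01 lexx.
have [bv|bv] := leP b v; first by rewrite (ramp_eq0 bv).1 ler01 lexx.
have va0 : 0 <= v - a by rewrite subr_ge0 ltW.
have vb0 : v - b <= 0 by rewrite subr_le0 ltW.
rewrite /ramp (max_r va0) (max_l vb0) subr0; apply/andP; split.
  by rewrite subr_ge0 ler_pdivrMr // mul1r lerD2r ltW.
by rewrite gerBl divr_ge0 // ltW // subr_gt0.
Qed.

Lemma is_derive_ramp_prim (v : R) : is_derive v 1 ramp_prim (ramp v).
Proof.
have shift c : is_derive v 1 (fun w : R => w - c) 1.
  by apply: is_derive_eq; rewrite subr0.
have H c := @is_derive1_comp _ (fun w => Num.max 0 w ^+ 2) (fun w => w - c) v _ _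
  (is_derive_sqr_max0 (v - c)) (shift c).
have Ha := H a; have Hb := H b; rewrite /comp in Ha Hb.
rewrite /ramp_prim; apply: is_derive_eq; rewrite /GRing.scale /= /ramp.
by field.
Qed.

(** [ramp_prim] being an antiderivative of [ramp], the numerator has derivative
    [(ramp (Phi x) - B) * phi x] and vanishes at both ends, which is the variation of
    constants formula for [f' - x f = ramp (Phi x) - B]. *)
Let f x : R := (ramp_prim (Phi x) - B * Phi x) / phi x.
Let df x : R := ramp (Phi x) - B + x * f x.
(** The derivative of [x * f x], the only part of [df] that needs an argument to be
    Lipschitz. *)
Let dxf x : R := (1 + x ^+ 2) * f x + x * (ramp (Phi x) - B).

Let phi_neq0 x : phi x != 0 :> R. Proof. by rewrite gt_eqF // phi_gt0. Qed.

Let fE (x : R) : is_derive x 1 f (df x).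
Proof.
have HP := is_derive_Phi x; have Hp := is_derive_phi x.
have HR := @is_derive1_comp _ ramp_prim Phi x _ _ (is_derive_ramp_prim _) HP.
have HV := is_deriveV (phi_neq0 x) Hp; rewrite /comp in HR.
apply: is_derive_eq; rewrite /GRing.scale /= /df /f.
by field.
Qed.

Let xfE (x : R) : is_derive x 1 (fun y => y * f y) (dxf x).
Proof.
by have H := fE x; apply: is_derive_eq; rewrite /GRing.scale /= /dxf /df; ring.
Qed.

Let Phi_lipschitz (x y : R) : `|Phi y - Phi x| <= normal_peak 1 * `|y - x|.
Proof.
apply: (derive_bounded_lipschitz (df := phi)) => z; first exact: is_derive_Phi.
by rewrite gtr0_norm ?phi_gt0 // phi_le.
Qed.

Let h_lipschitz (x y : R) : `|ramp (Phi y) - ramp (Phi x)|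
  <= (b - a)^-1 * normal_peak 1 * `|y - x|.
Proof.
apply: (le_trans (ramp_lipschitz _ _)).
by rewrite -mulrA ler_wpM2l ?invr_ge0 ?(ltW ba0).
Qed.

Let h_continuous : continuous (fun x : R => ramp (Phi x)).
Proof.
have cr : continuous ramp.
  move=> v; apply/cvgrPdist_le => e e0; near=> w.
  apply: (le_trans (ramp_lipschitz _ _)); rewrite mulrC ler_pdivrMr //.
  near: w; apply: cvgr_dist_le; [exact: cvg_id|exact: mulr_gt0].
move=> x; apply: continuous_comp; last exact: cr.
exact: is_derive1_continuous (is_derive_Phi x).
Unshelve. all: by end_near. Qed.

Let f_continuous : continuous f.
Proof. by move=> x; exact: is_derive1_continuous (fE x). Qed.

Let tails : exists2 X, 1 <= X & forall x, X <= x -> Phi (- x) <= a /\ b <= Phi x.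
Proof.
have : \forall x \near +oo, Phi (- x) <= a /\ b <= Phi x.
  near=> x; split; near: x.
    have H : Phi (- x) @[x --> +oo] --> (0 : R).
      exact: (cvgNy_compNP _ _).1 (@Phi_cvgNy R).
    exact: cvgr_le H _ a0.
  exact: cvgr_ge (@Phi_cvgy R) _ b1.
move=> [X [_ HX]]; exists (Num.max 1 (X + 1)); first by rewrite le_max lexx.
move=> x; rewrite ge_max => /andP[_ Xx]; apply: HX.
by apply: lt_le_trans Xx; rewrite ltrDl.
Unshelve. all: by end_near. Qed.

(** For large [x] the ramp vanishes and [f] is [B] times the Mills ratio of the upper
    tail; symmetrically on the left. *)
Let right_bounds x : 1 <= x -> b <= Phi x -> `|df x| <= 1 /\ `|dxf x| <= 1.
Proof.
move=> x1 bx; have [hx px] := ramp_eq0 bx.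
have [] := @mills_bounds R (fun x => 1 - Phi x) _ _ _ _ x1.
- by move=> y; rewrite subr_ge0 Phi_le1.
- by rewrite -(subrr 1); apply: cvgB; [exact: cvg_cst|exact: Phi_cvgy].
- move=> y; have H := is_derive_Phi y.
  by apply: is_derive_eq; rewrite add0r mul1r.
have B01 : `|B| <= 1 by move: a0 ab b1 => *; rewrite /B ger0_norm; lra.
move=> m1 m2; split.
  have -> : df x = B * (x * ((1 - Phi x) / phi x) - 1).
    by rewrite /df /f hx px; field.
  by rewrite normrM mulr_ile1.
have -> : dxf x = B * ((1 + x ^+ 2) * ((1 - Phi x) / phi x) - x).
  by rewrite /dxf /f hx px; field.
by rewrite normrM mulr_ile1.
Qed.

Let left_bounds x : 1 <= x -> Phi (- x) <= a ->
  `|df (- x)| <= 1 /\ `|dxf (- x)| <= 1.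
Proof.
move=> x1 xa; have [hx px] := ramp_eq1 xa.
have [] := @mills_bounds R (fun x => Phi (- x)) _ _ _ _ x1.
- by move=> y; exact: Phi_ge0.
- exact: (cvgNy_compNP _ _).1 (@Phi_cvgNy R).
- move=> y; have H := is_derive_Phi (- y).
  have HN : is_derive y 1 (fun z : R => - z) (- 1) by apply: is_derive_eq.
  have := @is_derive1_comp _ Phi (fun z => - z) y _ _ H HN.
  by rewrite /comp phiN mulrN1.
have B01 : `|1 - B| <= 1 by move: a0 ab b1 => *; rewrite /B ger0_norm; lra.
move=> m1 m2; split.
  have -> : df (- x) = - ((1 - B) * (x * (Phi (- x) / phi x) - 1)).
    by rewrite /df /f hx px phiN; field.
  by rewrite normrN normrM mulr_ile1.
have -> : dxf (- x) = (1 - B) * ((1 + x ^+ 2) * (Phi (- x) / phi x) - x).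
  by rewrite /dxf /f hx px phiN; field.
by rewrite normrM mulr_ile1.
Qed.

Lemma stein_solution : exists (f df : R -> R) (M L : R), [/\ 0 <= L,
  forall z : R, is_derive z 1 f (df z),
  forall z, `|df z| <= M,
  forall z w, `|df w - df z| <= L * `|w - z| &
  forall x, df x - x * f x = ramp (Phi x) - (a + b) / 2].
Proof.
have [X X1 HX] := tails.
have out x : X <= `|x| -> `|df x| <= 1 /\ `|dxf x| <= 1.
  move=> Xx; have [pa pb] := HX _ Xx; have x1 := le_trans X1 Xx.
  have [x0|x0] := leP 0 x.
    by rewrite ger0_norm // in x1 pb; exact: right_bounds.
  by rewrite ltr0_norm // in x1 pa; rewrite -(opprK x); exact: left_bounds.
have hB : continuous (fun x => ramp (Phi x) - B).
  by move=> x; apply: cvgB; [exact: h_continuous|exact: cvg_cst].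
have cdf : continuous df.
  move=> x; apply: cvgD; first exact: hB.
  by apply: cvgM; [exact: cvg_id|exact: f_continuous].
have cdxf : continuous dxf.
  move=> x; apply: cvgD; apply: cvgM.
  - apply: cvgD; first exact: cvg_cst.
    by apply: cvgM; exact: cvg_id.
  - exact: f_continuous.
  - exact: cvg_id.
  - exact: hB.
have [M HM] := bounded_from_tails cdf (fun x Xx => (out x Xx).1).
have [N HN] := bounded_from_tails cdxf (fun x Xx => (out x Xx).2).
have N0 : 0 <= N := le_trans (normr_ge0 _) (HN 0).
exists f, df, M, ((b - a)^-1 * normal_peak 1 + N); split => //.
- by rewrite addr_ge0 // mulr_ge0 ?invr_ge0 ?(ltW ba0) // normal_peak_ge0.
- move=> z w.
  have -> : df w - df z = ramp (Phi w) - ramp (Phi z) + (w * f w - z * f z).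
    by rewrite /df; ring.
  rewrite (le_trans (ler_normD _ _)) // mulrDl lerD ?h_lipschitz //.
  exact: (derive_bounded_lipschitz (f := fun y => y * f y)).
- by move=> x; rewrite /df addrK.
Qed.

End SteinSolution.

(** * From the random configuration to finite sums *)

Section Transfer.
Context {R : realType} {V : finType} {d : measure_display} {T : measurableType d}.
Variables (Pr : probability T R) (xi : V -> {RV Pr >-> bool}).
Variable Gamma : {ffun V -> bool} -> R.
Hypothesis lawG : has_law xi Gamma.

Definition configuration (w : T) : {ffun V -> bool} := [ffun x => xi x w].

Lemma expectation_law (g : {ffun V -> bool} -> R) :
  'E_Pr[fun w => g (configuration w)]%E = (expect Gamma g)%:E.
Proof.
pose A eta := [set w | configuration w = eta].
have AE eta : A eta = [set w | forall x, xi x w = eta x].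
  apply/seteqP; split => w /=.
    by move=> <- x; rewrite ffunE.
  by move=> H; apply/ffunP => x; rewrite ffunE H.
have mA eta : measurable (A eta).
  rewrite AE (_ : [set w | _] = \bigcap_(x in [set: V]) (xi x @^-1` [set eta x])).
    apply: fin_bigcap_measurable => // x _.
    by rewrite -[X in measurable X]setTI; exact: measurable_funP.
  by apply/seteqP; split => w /= H x; [move=> _|]; exact: H.
rewrite unlock.
have -> : (fun w => (g (configuration w))%:E) =
    (fun w => \sum_(eta : {ffun V -> bool}) ((g eta)%:E * (\1_(A eta) w)%:E))%E.
  apply/funext => w; rewrite (bigD1 (configuration w)) //= big1 => [|eta ne].
    by rewrite indicE mem_set //= mule1 adde0.
  by rewrite indicE memNset ?mule0 // => /esym/eqP; apply/negP.
have iA eta : Pr.-integrable [set: T] (fun w => (\1_(A eta) w)%:E).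
  exact: integrable_indic.
rewrite integral_sum // => [|eta]; last exact: integrableZl.
rewrite /expect -sumEFin; apply: eq_bigr => eta _.
rewrite integralZl // integral_indic // setIT AE mulrC EFinM.
congr (_ * _)%E; exact: lawG.
Qed.

Variable pi : V -> R.

Lemma S_stat_wsum w : S_stat pi xi w = wsum pi (configuration w).
Proof. by apply: eq_bigr => x _; rewrite ffunE. Qed.

Lemma expectation_S_stat : 'E_Pr[S_stat pi xi]%E = (expect Gamma (wsum pi))%:E.
Proof.
rewrite (_ : S_stat pi xi = fun w => wsum pi (configuration w)).
  exact: expectation_law.
by apply/funext => w; rewrite S_stat_wsum.
Qed.

Lemma sigma_law : sigma pi xi = Num.sqrt (var Gamma (wsum pi)).
Proof.
rewrite /sigma /variance covariance.unlock expectation_S_stat /=.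
pose g eta := (wsum pi eta - expect Gamma (wsum pi)) ^+ 2.
rewrite (_ : (_ * _)%R = fun w => g (configuration w)).
  by rewrite expectation_law.
by apply/funext => w; rewrite fctE /= S_stat_wsum -expr2.
Qed.

Lemma cdf_W_law (t : R) : cdf (W_rv pi xi) t =
  (expect Gamma (fun eta => ((wsum pi eta - expect Gamma (wsum pi)) /
     Num.sqrt (var Gamma (wsum pi)) <= t)%R%:R))%:E.
Proof.
rewrite -expectation_law /cdf /distribution /pushforward /=.
have mW : measurable (W_rv pi xi @^-1` `]-oo, t]).
  by rewrite -[X in measurable X]setTI; exact: measurable_funP.
rewrite -(expectation_indic Pr mW); congr expectation.
apply/funext => w; rewrite indicE; congr (_%:R : R).
have -> : (w \in W_rv pi xi @^-1` `]-oo, t]) = (W_stat pi xi w <= t).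
  by apply/idP/idP => [/set_mem|H]; [|apply/mem_set]; rewrite /= in_itv.
by rewrite /W_stat expectation_S_stat sigma_law S_stat_wsum.
Qed.

End Transfer.

(** * Convergence of the distribution functions *)

Section Rate.
Context {R : realType} {V : finType}.
Variables (P : V -> V -> R) (p : R) (pi : V -> R).

(** Since [nu^2 <= n * pi_star^2], the factor [(pi_star / nu)^2 * n] is at least 1. *)
Lemma rate_le : stationary P pi -> 0 < p <= 1 ->
  0 <= pi_star pi / nu pi / p <= (pi_star pi / nu pi) ^+ 3 * (#|V|%:R / p).
Proof.
move=> stP /andP[p0 p1]; have [pi0 pi1] := stP.1.
have nu0 := nu_gt0 stP.
set r := pi_star pi / nu pi; have r0 : 0 <= r by rewrite divr_ge0 ?pi_star_ge0 // ltW.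
rewrite divr_ge0 ?(ltW p0) //= mulrA ler_wpM2r ?invr_ge0 ?(ltW p0) //.
rewrite exprS -mulrA ler_peMr // /r expr_div_n mulrAC ler_pdivlMr ?exprn_gt0 //.
rewrite mul1r nu_sqr.
rewrite mulrC mulr_natl -sumr_const; apply: ler_sum => x _.
by rewrite lerXn2r ?nnegrE ?pi_star_ge0 ?pi_le_star.
Qed.

End Rate.

Lemma Phi_in01 (R : realType) (t : R) : 0 < Phi t < 1.
Proof.
have inc (s : R) : Phi s < Phi (s + 1).
  have [||c [_ _ E]] := @MVT_ray R Phi phi (s - 1) s (s + 1)
    (fun z _ => is_derive_Phi z).
  - by rewrite gtrBl.
  - by rewrite ltrD2l gtrN.
  by rewrite -subr_gt0 E [s + 1 - s]addrC addKr mulr1 phi_gt0.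
apply/andP; split; last exact: lt_le_trans (inc t) (Phi_le1 _).
by have := inc (t - 1); rewrite subrK; apply: le_lt_trans; exact: Phi_ge0.
Qed.

Lemma Phi_nondecreasing (R : realType) (s t : R) : s <= t -> Phi s <= Phi t.
Proof.
move=> st; rewrite -lee_fin -!normal_prob_Phi le_measure ?inE //.
by apply: subset_itvl; rewrite bnd_simp.
Qed.

Theorem corollary3 (R : realType) (V : nat -> finType)
  (P : forall n, V n -> V n -> R) (pi : forall n, V n -> R) (p : nat -> R)
  (Gamma : forall n, {ffun V n -> bool} -> R)
  (d : nat -> measure_display) (T : forall n, measurableType (d n))
  (Pr : forall n, probability (T n) R)
  (xi : forall n, V n -> {RV (Pr n) >-> bool}) :
  (forall n, (0 < n)%N -> #|V n| = n) ->
  (forall n, (0 < n)%N -> stochastic (P n)) ->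
  (forall n, (0 < n)%N -> irreducible (P n)) ->
  (forall n, (0 < n)%N -> stationary (P n) (pi n)) ->
  (forall n, (0 < n)%N -> 0 < p n <= 1) ->
  (forall m n, (0 < m)%N -> (m <= n)%N -> p n <= p m) ->
  (forall n, (0 < n)%N -> stationary (nvm (P n) (p n)) (Gamma n)) ->
  (forall n, (0 < n)%N -> has_law (xi n) (Gamma n)) ->
  ((pi_star (pi n) / nu (pi n)) ^+ 3 * (n%:R / p n)) @[n --> \oo] --> (0 : R) ->
  cvg_in_distribution (fun n => W_rv (pi n) (xi n)) (normal_prob (0 : R) 1).
Proof.
move=> cardV sP _ stP p01 _ stG law rate0 t _.
pose sd n := Num.sqrt (var (Gamma n) (wsum (pi n))).
pose W n eta := (wsum (pi n) eta - 2^-1) / sd n.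
pose F n := expect (Gamma n) (fun eta => (W n eta <= t)%R%:R).
pose eps n := pi_star (pi n) / nu (pi n) / p n.
have pos : \forall n \near \oo, (0 < n)%N by exists 1.
have cdfE : \forall n \near \oo, cdf (W_rv (pi n) (xi n)) t = (F n)%:E.
  near=> n; have n0 : (0 < n)%N by near: n.
  rewrite (cdf_W_law (law n n0)) (expect_wsum (sP _ n0) (stP _ n0) (p01 _ n0)) //.
  exact: stG.
have eps0 : eps n @[n --> \oo] --> (0 : R).
  apply: (squeeze_cvgr _ (cvg_cst (0 : R)) rate0); near=> n.
  have n0 : (0 < n)%N by near: n.
  by have := rate_le (stP n n0) (p01 n n0); rewrite cardV.
have smooth (a b e : R) : 0 < a -> a < b -> b < 1 -> 0 < e -> \forall n \near \oo,
    `|expect (Gamma n) (fun eta => ramp a b (Phi (W n eta))) - (a + b) / 2| <= e.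
  move=> a0 ab b1 e0.
  have [f [df [M [L [L0 fE dfM dfL fS]]]]] := stein_solution a0 ab b1.
  have cv0 : (3 * M + 4 * L) * eps n @[n --> \oo] --> (3 * M + 4 * L) * (0 : R).
    exact: cvgMr.
  rewrite mulr0 in cv0; near=> n; have n0 : (0 < n)%N by near: n.
  have pG := (stG n n0).1.
  apply: (@le_trans _ _ ((3 * M + 4 * L) * eps n)); last first.
    by near: n; exact: cvgr_le cv0 _ e0.
  rewrite -[X in _ - X](expect_cst _ pG) -expectB.
  rewrite (eq_expect _ (fun eta => esym (fS (W n eta)))).
  exact: (nvm_stein (sP n n0) (stP n n0) (p01 n n0) (stG n n0) fE dfM dfL L0).
have Fcvg : F n @[n --> \oo] --> Phi t.
  have /andP[u0 u1] := Phi_in01 t; set u := Phi t in u0 u1 *.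
  apply/cvgrPdist_le => e e0.
  (* The ramps live on [u - e1, u] and [u, u + e1], which must stay inside the open
     unit interval. *)
  pose e1 := Num.min (e / 2) (Num.min (u / 2) ((1 - u) / 2)).
  have [e1_gt0 e1e e1u e1v] : [/\ 0 < e1, e1 <= e / 2, e1 <= u / 2 & e1 <= (1 - u) / 2].
    by rewrite /e1 !lt_min !ge_min !lexx !orbT !divr_gt0 // subr_gt0.
  have e20 : 0 < e / 2 by rewrite divr_gt0.
  near=> n; have n0 : (0 < n)%N by near: n.
  have pG := (stG n n0).1.
  rewrite ler_distlC; apply/andP; split.
    have : `|expect (Gamma n) (fun eta => ramp (u - e1) u (Phi (W n eta)))
        - (u - e1 + u) / 2| <= e / 2 by near: n; apply: smooth => //; lra.
    rewrite ler_distl => /andP[lo _].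
    apply: (@le_trans _ _ (expect (Gamma n)
      (fun eta => ramp (u - e1) u (Phi (W n eta))))).
      lra.
    have lu : u - e1 < u by rewrite gtrBl.
    apply: le_expect => // eta; case: (leP (W n eta) t) => /= Wt.
      by have /andP[] := ramp_ge0_le1 lu (Phi (W n eta)).
    by rewrite (ramp_eq0 lu (Phi_nondecreasing (ltW Wt))).1.
  have : `|expect (Gamma n) (fun eta => ramp u (u + e1) (Phi (W n eta)))
      - (u + (u + e1)) / 2| <= e / 2 by near: n; apply: smooth => //; lra.
  rewrite ler_distl => /andP[_ hi].
  apply: (@le_trans _ _ (expect (Gamma n)
    (fun eta => ramp u (u + e1) (Phi (W n eta)))));
    last by lra.
  have uu : u < u + e1 by rewrite ltrDl.
  apply: le_expect => // eta; case: (leP (W n eta) t) => /= Wt.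
    by rewrite (ramp_eq1 uu (Phi_nondecreasing Wt)).1.
  by have /andP[] := ramp_ge0_le1 uu (Phi (W n eta)).
have : (F n)%:E @[n --> \oo] --> (Phi t)%:E.
  by apply: cvg_EFin => //; exact: nearW.
rewrite -normal_prob_Phi; apply: cvg_trans; apply: near_eq_cvg.
by apply: filterS cdfE => n /= ->.
Unshelve. all: by end_near. Qed.
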